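(* Let $k,l\ge 0$ and $s\ge \max(k+l,1)$ be integers and let $\nu\in\mathsf{P}_s(2s-k-l)$ be any partition of $2s-k-l$ into exactly $s$ parts. Then \begin{align*} s!&=\sum_{\substack{(r-l)+p_1+\dots+p_l=s\\ r-l\ge k,\ p_1,\dots,p_l\ge 1}}\ \sum_{\mu\in\mathsf{P}_{r-l}(2r-k-2l)}\ \sum_{\rho_1\in\mathsf{P}_{p_1}(2p_1-1)}\cdots\sum_{\rho_l\in\mathsf{P}_{p_l}(2p_l-1)}\binom{\nu}{\mu,\rho_1,\dots,\rho_l}\,(r-l)!\,(p_1-1)!\cdots(p_l-1)!\,, \end{align*} where the outer sum runs over all integer tuples $(r,p_1,\dots,p_l)$ satisfying the displayed conditions.
   Context: For integers $n\geq 1$ and $1\le k\le n$, $\mathsf{P}_k(n)$ denotes the set of partitions of the integer $n$ into exactly $k$ (positive) parts. By convention $\mathsf{P}_0(0)$ consists of the single empty partition. Multinomial coefficient of partitions: suppose the partition $\nu$ has exactly $h_i$ parts equal to $i$ (for each $i\ge 1$) and, for $j=1,\dots,m$, the partition $\mu_j$ has exactly $g_{i,j}$ parts equal to $i$. Then $$\binom{\nu}{\mu_1,\dots,\mu_m}:=\prod_{i\ge 1}\binom{h_i}{g_{i,1},\dots,g_{i,m}},$$ where only finitely many factors differ from $1$, and where $\binom{h}{g_1,\dots,g_m}=\frac{h!}{g_1!\cdots g_m!}$ if $h=g_1+\dots+g_m$ and $\binom{h}{g_1,\dots,g_m}=0$ otherwise. For $l=0$ there are no $p_i$ and no $\rho_i$.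 *)

(* Defs.v *)
From HB Require Import structures.
From mathcomp Require Import all_boot all_order all_algebra.
From mathcomp Require Import zify.

Set Implicit Arguments.
Unset Strict Implicit.
Unset Printing Implicit Defensive.

(* A partition is encoded as its weakly decreasing sequence of positive
   parts.  For k = n = 0 the only such sequence is the empty one. *)
Definition is_intpart (k n : nat) (p : seq nat) : bool :=
  [&& sorted geq p, all (fun x => 0 < x) p, size p == k & sumn p == n].

Record intpart (k n : nat) := IntPart {
  parts :> seq nat;
  _ : is_intpart k n parts
}.

HB.instance Definition _ (k n : nat) := [isSub for @parts k n].
HB.instance Definition _ (k n : nat) := [Countable of intpart k n by <:].

(* Finiteness: all parts are at most n, so partitions embed into
   k-tuples over 'I_n.+1. *)
Definition intpart_tuple (k n : nat) (p : intpart k n) : k.-tuple 'I_n.+1 :=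
  [tuple inord (nth 0 p i) | i < k].

Definition tuple_intpart (k n : nat) (t : k.-tuple 'I_n.+1) :
    option (intpart k n) :=
  insub (map val t).

Lemma leq_sumn (x : nat) (s : seq nat) : x \in s -> x <= sumn s.
Proof.
elim: s => //= y s IHs; rewrite inE => /orP[/eqP->|/IHs xs].
  by rewrite leq_addr.
by rewrite (leq_trans xs) // leq_addl.
Qed.

Lemma intpart_tupleK (k n : nat) :
  pcancel (@intpart_tuple k n) (@tuple_intpart k n).
Proof.
case=> p pP; rewrite /tuple_intpart.
suff -> : map val (intpart_tuple (IntPart pP)) = p by rewrite insubT.
have [_ _ /eqP sz_p /eqP sum_p] := and4P pP.
apply: (@eq_from_nth _ 0) => [|i]; rewrite size_map size_tuple // => lt_ik.
rewrite (nth_map ord0) ?size_tuple // -[i]/(val (Ordinal lt_ik)) -tnth_nth.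
rewrite tnth_mktuple /= inordK // ltnS -[X in _ <= X]sum_p.
by rewrite leq_sumn // mem_nth // sz_p.
Qed.

HB.instance Definition _ (k n : nat) : isFinite (intpart k n) :=
  PCanIsFinite (@intpart_tupleK k n).

Definition multinom (h : nat) (gs : seq nat) : nat :=
  if h == sumn gs then h`! %/ \prod_(g <- gs) g`! else 0.

Lemma dvdn_prod_fact (gs : seq nat) : \prod_(g <- gs) g`! %| (sumn gs)`!.
Proof.
elim: gs => [|g gs IHgs]; first by rewrite big_nil.
rewrite big_cons /= -(bin_fact (leq_addr (sumn gs) g)) addKn.
by rewrite dvdn_mull // dvdn_mul.
Qed.

(* The product over all i >= 1 is cut off at the largest part occurring in
   nu or in one of the mus; partmultinom_widen shows that the cut-off is
   immaterial. *)
Definition partmultinom (nu : seq nat) (mus : seq (seq nat)) : nat :=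
  \prod_(1 <= i < (\max_(x <- nu ++ flatten mus) x).+1)
    multinom (count_mem i nu) [seq count_mem i mu | mu <- mus].

Lemma partmultinom_widen (nu : seq nat) (mus : seq (seq nat)) (N : nat) :
  \max_(x <- nu ++ flatten mus) x <= N ->
  partmultinom nu mus =
  \prod_(1 <= i < N.+1)
    multinom (count_mem i nu) [seq count_mem i mu | mu <- mus].
Proof.
move=> leN; set M := \max_(x <- _) x in leN *.
rewrite /partmultinom -/M [RHS](@big_cat_nat _ _ _ M.+1) //=.
rewrite [X in _ * X]big_nat_cond [X in _ * X]big1 ?muln1 // => i.
rewrite andbT => /andP[lt_mi _].
have : i \notin nu ++ flatten mus.
  apply/negP => i_in; move: lt_mi; rewrite ltnNge => /negP[].
  exact: (@leq_bigmax_seq _ _ xpredT id i).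
rewrite mem_cat negb_or => /andP[/count_memPn -> i_mus].
suff -> : [seq count_mem i mu | mu <- mus] = nseq (size mus) 0.
  rewrite /multinom sumn_nseq mul0n eqxx.
  by rewrite big_nseq; elim: (size mus) => /= [|n]; rewrite ?divn1 ?mul1n.
elim: mus i_mus {M leN lt_mi} => //= mu mus IHmus.
by rewrite mem_cat negb_or => /andP[/count_memPn -> /IHmus ->].
Qed.

(* Justifies summing over bounded natural numbers instead of over integers. *)
Lemma outer_index_bounded (k l s : nat) (r : int) (p : 'I_l -> int) :
  (r - l%:Z + \sum_(i < l) p i = s%:Z)%R ->
  (k%:Z <= r - l%:Z)%R -> (forall i, 1 <= p i)%R ->
  (l%:Z <= r <= (s + l)%:Z)%R /\ (forall i, 0 <= p i <= s%:Z)%R.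
Proof.
move=> sum_eq le_kr p_ge1.
have sum_ge0 (P : pred 'I_l) : (0 <= \sum_(i < l | P i) p i)%R.
  by apply: Num.Theory.sumr_ge0 => i _; have := p_ge1 i; lia.
split=> [|i]; first by have := sum_ge0 xpredT; lia.
move: sum_eq (sum_ge0 (fun j => j != i)) (p_ge1 i); rewrite (bigD1 i) //=.
by move: (\sum_(j < l | _) _)%R => S; lia.
Qed.

(* Main.v *)
Require Import Defs.
From mathcomp Require Import all_boot all_order all_algebra.
From mathcomp Require Import zify.

(** Give the [t]-th part [nu_t] of [nu] the weight [2 - nu_t], an integer that
    is at most [1]; the total weight of [nu] is [k + l].  The multinomial
    coefficient of [nu] over [mu, rho_1, ..., rho_l] is the number of ways to
    colour the [s] parts with the colours [None] (for [mu]) and [Some i] (for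
    [rho_i]) so that every colour class is the prescribed partition
    ([partmultinomE]).  The conditions on the sizes of the [rho_i] say that
    every class [Some i] has weight [1]; the class [None] then automatically
    has weight [k], and [r] and the [p_i] are determined by the colouring.  So
    the theorem says that [s!] is the sum, over the colourings whose classes
    [Some i] all have weight [1], of
    [(size of class None)! * prod_i (size of class i - 1)!]
    ([unit_coloring_count]).

    That sum is evaluated by removing one colour at a time, that is, by merging
    its class into the class [None].  The step is a statement on one finite set
    [S] of positive weight whose elements have weight at most [1]
    ([sum_unit_subset_fact]):
    [sum over A in S of weight 1 of (#|A| - 1)! * #|S \ A|! = #|S|!].

    Its proof carries the following correction term: for [S] of arbitrary
    weight, the left-hand side plus the number of orderings of [S] all of whose
    suffixes have weight at most [0] equals [#|S|!]
    ([num_cycle_order_add_nonpos]).  This goes by induction on [S], as both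
    terms satisfy nearly the same recursion when an element of [S] is removed.
    The only discrepancy is at weight [1], where the first term gains
    [(#|S| - 1)!], and the cycle lemma of Dvoretzky and Motzkin shows that the
    second one loses as much: exactly one rotation of a word of weight [1] has
    all its proper suffixes of weight at most [0]. *)

Set Implicit Arguments.
Unset Strict Implicit.
Unset Printing Implicit Defensive.

(** * Orderings of a finite set and the cycle lemma *)

Lemma sum_permutations_cons (T : finType) (S : {set T}) (F : seq T -> nat) :
  S != set0 ->
  \sum_(u <- permutations (enum S)) F u =
  \sum_(x in S) \sum_(u <- permutations (enum (S :\ x))) F (x :: u).
Proof.
move=> S_neq0; rewrite -[RHS]big_enum /=.
rewrite -(big_allpairs_dep (h := fun x u => x :: u)
  (r2 := fun x => permutations (enum (S :\ x)))).
apply: perm_big; apply: uniq_perm; first exact: permutations_uniq.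
  apply: allpairs_uniq_dep => [|x _|]; rewrite ?enum_uniq ?permutations_uniq //.
  by case=> [x u] [y v] _ _ /= [-> ->].
have perm_tail x u : x \in S ->
    perm_eq (x :: u) (enum S) = perm_eq u (enum (S :\ x)).
  move=> xS; rewrite -(perm_cons x u).
  suff /permPr -> : perm_eq (enum S) (x :: enum (S :\ x)) by [].
  apply: uniq_perm => [||y]; rewrite /= ?enum_uniq ?mem_enum ?setD11 //.
  by rewrite inE !mem_enum !inE; case: eqP => // ->.
move=> u; rewrite mem_permutations; apply/idP/allpairsPdep.
  case: u => [/perm_size|x u eq_u].
    by move/esym/eqP; rewrite -cardE cards_eq0 (negPf S_neq0).
  have xS : x \in S by rewrite -mem_enum -(perm_mem eq_u) mem_head.
  by exists x, u; rewrite mem_enum mem_permutations -perm_tail.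
case=> x [v] []; rewrite mem_enum => xS + ->.
by rewrite mem_permutations perm_tail.
Qed.

Fixpoint nonpos_suffixes (T : Type) (w : T -> int) (u : seq T) : bool :=
  if u is _ :: v then (\sum_(x <- u) w x <= 0)%R && nonpos_suffixes w v
  else true.

Lemma nonpos_suffixesP (T : Type) (w : T -> int) (u : seq T) :
  reflect (forall j, \sum_(x <- drop j u) w x <= 0)%R (nonpos_suffixes w u).
Proof.
elim: u => [|x u IHu] /=; first by left=> j; rewrite big_nil.
apply: (iffP andP) => [[sum_u /IHu suff_u] [|j] //=|suff_u].
by split; [have := suff_u 0 | apply/IHu => j; have := suff_u j.+1].
Qed.

(** With [P j] the weight of the first [j] letters, the weight of a suffix of
    the [i]-th rotation is [P i - P j] if it starts at a position [j < i], and
    [P i - P j + 1] if it starts at a position [j > i].  So the rotation is good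
    if and only if [i] is the last position where [P] attains its minimum. *)
Lemma cycle_lemma (T : Type) (w : T -> int) (u : seq T) :
  (\sum_(x <- u) w x = 1)%R ->
  \sum_(i < size u) nonpos_suffixes w (behead (rot i u)) = 1.
Proof.
move=> sum_u.
have u_gt0 : 0 < size u by case: u sum_u => //; rewrite big_nil.
pose P j : int := (\sum_(x <- take j u) w x)%R.
have P_drop i j : i <= j -> (\sum_(x <- drop i (take j u)) w x = P j - P i)%R.
  move=> le_ij; rewrite /P -[in RHS](cat_take_drop i (take j u)) big_cat /=.
  by rewrite take_takel // GRing.addrAC GRing.subrr GRing.add0r.
have Pu : P (size u) = 1%R by rewrite /P take_size.
have P_rot i j : i < size u -> j < size u ->
    (\sum_(x <- drop j (rot i u)) w x =
      if (i + j < size u)%N then P i + 1 - P (i + j)%N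
      else P i - P (i + j - size u)%N)%R.
  move=> lt_i lt_j; rewrite /rot drop_cat size_drop.
  have -> : (j < size u - i) = (i + j < size u) by lia.
  case: ifP => lt_ij; last first.
    have -> : j - (size u - i) = i + j - size u by lia.
    by rewrite P_drop //; lia.
  rewrite big_cat /= drop_drop -{1}[u]take_size P_drop; [|lia].
  by rewrite -/(P i) Pu addnC; lia.
pose good i := nonpos_suffixes w (behead (rot i u)).
have goodE i : reflect
    (forall j : 'I_(size u), 0 < j -> (\sum_(x <- drop j (rot i u)) w x <= 0)%R)
    (good i).
  apply: (iffP (nonpos_suffixesP _ _)) => good_i j.
    by case: j => [[|j] lt_j] //= _; have := good_i j; rewrite -drop1 drop_drop addn1.
  rewrite -drop1 drop_drop addn1; have [lt_j|le_j] := ltnP j.+1 (size u).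
    exact: (good_i (Ordinal lt_j)).
  by rewrite drop_oversize ?size_rot // big_nil.
have goodP (i : 'I_(size u)) : reflect
    (forall j : 'I_(size u), (P i <= P j)%R /\ (i < j -> (P i < P j)%R)) (good i).
  apply: (iffP (goodE i)) => [good_i j | min_i j].
    have [lt_ij|lt_ji|/val_inj eq_ij] := ltngtP i j.
    - have lt : j - i < size u by have := ltn_ord j; lia.
      have := good_i (Ordinal lt); rewrite P_rot //= subnKC; last lia.
      by rewrite ltn_ord; lia.
    - have lt : size u + j - i < size u by have := ltn_ord i; lia.
      have := good_i (Ordinal lt); rewrite P_rot //=.
      have -> : i + (size u + j - i) = size u + j by have := ltn_ord i; lia.
      rewrite ifN; last lia.
      have -> : size u + j - size u = j by lia.
      by have := ltn_ord i; lia.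
    - by rewrite eq_ij; split.
  move=> j_gt0; rewrite P_rot //.
  case: ifP => lt_ij.
    by have [_] := min_i (Ordinal lt_ij); rewrite /=; lia.
  have lt : i + j - size u < size u by have := ltn_ord i; have := ltn_ord j; lia.
  by have [] := min_i (Ordinal lt); rewrite /=; lia.
pose i0 : 'I_(size u) := Ordinal u_gt0.
pose i1 : 'I_(size u) := [arg min_(i < i0) P i]%O.
have min_i1 (j : 'I_(size u)) : (P i1 <= P j)%R.
  by rewrite /i1; case: Order.TotalTheory.arg_minP => // i _; apply.
pose i2 : 'I_(size u) := [arg max_(i > i1 | P i == P i1) val i]%N.
have [P_i2 max_i2] : P i2 = P i1 /\ forall j : 'I_(size u), P j = P i1 -> j <= i2.
  rewrite /i2; case: arg_maxnP => // i /eqP P_i max_i; split=> // j /eqP P_j.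
  exact: max_i.
have good_i2 : good i2.
  apply/goodP => j; have le_j := min_i1 j; split; first by rewrite P_i2.
  rewrite P_i2 => lt_ij; have := max_i2 j; lia.
rewrite (bigD1 i2) //= -/(good i2) good_i2 big1 ?addn0 // => i ne_i.
apply/eqP; rewrite eqb0; apply/negP => /goodP good_i.
have [le1 lt1] := good_i i2; have /goodP/(_ i) [le2 lt2] := good_i2.
by move: ne_i; rewrite -val_eqE /=; lia.
Qed.

Lemma sum_permutations_rot (T : eqType) (i : nat) (s : seq T)
    (F : seq T -> nat) :
  \sum_(u <- permutations s) F (rot i u) = \sum_(u <- permutations s) F u.
Proof.
rewrite -(big_map (rot i) xpredT F); apply: perm_big; apply: uniq_perm.
- by rewrite (map_inj_uniq (@rot_inj i T)) permutations_uniq.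
- exact: permutations_uniq.
move=> u; apply/mapP/idP => [[v + ->]|perm_u].
  by rewrite !mem_permutations perm_rot.
exists (rotr i u); last by rewrite rotrK.
by rewrite mem_permutations perm_rotr -mem_permutations.
Qed.

Definition num_nonpos (T : finType) (w : T -> int) (S : {set T}) : nat :=
  \sum_(u <- permutations (enum S)) nonpos_suffixes w u.

Lemma sum1_permutations (T : finType) (S : {set T}) :
  \sum_(u <- permutations (enum S)) 1 = #|S|`!.
Proof. by rewrite sum1_size size_permutations ?enum_uniq // -cardE. Qed.

Lemma sum_permutation (T : finType) (w : T -> int) (S : {set T}) u :
  u \in permutations (enum S) ->
  (\sum_(x <- u) w x = \sum_(x in S) w x)%R.
Proof. by rewrite mem_permutations => eq_u; rewrite (perm_big _ eq_u) big_enum. Qed.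

(** The left-hand side counts the orderings of [S] whose proper suffixes have
    weight at most [0].  Averaging over the [#|S|] rotations of an ordering,
    the cycle lemma shows that they are one in [#|S|] of all orderings. *)
Lemma sum_num_nonpos_eq1 (T : finType) (w : T -> int) (S : {set T}) :
  (\sum_(x in S) w x = 1)%R ->
  \sum_(x in S) num_nonpos w (S :\ x) = (#|S| - 1)`!.
Proof.
move=> sum_S; have S_neq0 : S != set0.
  by apply: contra_eqN sum_S => /eqP->; rewrite big_set0.
have S_gt0 : 0 < #|S| by rewrite card_gt0.
rewrite -(sum_permutations_cons (fun u => nonpos_suffixes w (behead u))) //.
apply/eqP; rewrite -(eqn_pmul2l S_gt0); apply/eqP.
transitivity (#|S|`!); last by case: #|S| S_gt0 => // n _; rewrite subn1 factS.
rewrite -[X in X * _]card_ord -sum_nat_const.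
under eq_bigr => i _ do rewrite -(sum_permutations_rot i).
rewrite exchange_big /= -sum1_permutations.
rewrite big_seq [RHS]big_seq; apply: eq_bigr => u u_S.
have sz_u : #|S| = size u.
  by move: u_S; rewrite mem_permutations cardE => /perm_size.
by rewrite sz_u cycle_lemma // (sum_permutation _ u_S).
Qed.

Lemma num_nonpos0 (T : finType) (w : T -> int) (S : {set T}) :
  (0 < \sum_(x in S) w x)%R -> num_nonpos w S = 0.
Proof.
move=> sum_S; rewrite /num_nonpos big_seq big1 // => u u_S; apply/eqP.
rewrite eqb0; apply/nonpos_suffixesP => /(_ 0).
by rewrite drop0 (sum_permutation _ u_S); lia.
Qed.

Lemma num_nonpos_rec (T : finType) (w : T -> int) (S : {set T}) :
  S != set0 -> (\sum_(x in S) w x <= 0)%R ->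
  num_nonpos w S = \sum_(x in S) num_nonpos w (S :\ x).
Proof.
move=> S_neq0 sum_S.
rewrite -(sum_permutations_cons (fun u => nonpos_suffixes w (behead u))) //.
rewrite /num_nonpos big_seq [RHS]big_seq; apply: eq_bigr => -[|x u] // u_S /=.
by rewrite (sum_permutation _ u_S) sum_S.
Qed.

(** * Subsets of weight one *)

(** This counts the ways to choose a subset [A] of weight [1], a cyclic order
    on [A] and a linear order on the rest of [S]. *)
Definition num_cycle_order (T : finType) (w : T -> int) (S : {set T}) : nat :=
  \sum_(A : {set T} | (A \subset S) && (\sum_(x in A) w x == 1)%R)
    (#|A| - 1)`! * #|S :\: A|`!.

(** Distinguish the element that comes first in the linear order on [S \ A].
    There is none if [A = S], which accounts for the additional term. *)
Lemma num_cycle_order_rec (T : finType) (w : T -> int) (S : {set T}) :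
  num_cycle_order w S =
  (if (\sum_(x in S) w x == 1)%R then (#|S| - 1)`! else 0) +
  \sum_(x in S) num_cycle_order w (S :\ x).
Proof.
rewrite /num_cycle_order (exchange_big_dep
  (fun A : {set T} => (A \subset S) && (\sum_(x in A) w x == 1)%R)) /=; last first.
  by move=> x A xS; rewrite subsetD1 => /andP[/andP[-> _] ->].
have rec (A : {set T}) : A \proper S -> (\sum_(x in A) w x == 1)%R ->
  (#|A| - 1)`! * #|S :\: A|`! =
  \sum_(x in S | (A \subset S :\ x) && (\sum_(x in A) w x == 1)%R)
     (#|A| - 1)`! * #|(S :\ x) :\: A|`!.
  move=> /properP[sAS [y yS yA]] wA.
  rewrite (eq_bigl (fun x => x \in S :\: A)); last first.
    by move=> x; rewrite subsetD1 sAS wA andbT !inE andbC.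
  rewrite (eq_bigr (fun=> (#|A| - 1)`! * (#|S :\: A|.-1)`!)); last first.
    move=> x xSA; rewrite setDDl [[set x] :|: A]setUC -setDDl.
    by rewrite (cardsD1 x (S :\: A)) xSA.
  rewrite sum_nat_const mulnCA; congr (_ * _).
  have : 0 < #|S :\: A| by apply/card_gt0P; exists y; rewrite inE yA.
  by case: #|S :\: A| => // n _; rewrite factS.
case: ifP => wS; last first.
  apply: eq_bigr => A /andP[sAS wA]; apply: rec => //.
  by rewrite properEneq sAS andbT; apply: contraFneq wS => <-.
rewrite (bigD1 S) ?subxx //= setDv cards0 muln1; congr (_ + _).
rewrite [RHS](bigD1 S) ?subxx //= [X in X + _]big1 ?add0n; last first.
  by move=> x /and3P[xS]; rewrite subsetD1 xS andbF.
apply: eq_bigr => A /andP[/andP[sAS wA] neqA]; apply: rec => //.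
by rewrite properEneq sAS neqA.
Qed.

(** By [num_cycle_order_rec], the first term follows the recursion
    [F S = sum_x F (S \ x)] of [#|S|!] except at weight [1]; by
    [num_nonpos_rec], so does the second one at weight at most [0].  At weight
    at least [2], removing an element leaves a positive weight, so both sides
    of the recursion of the second term vanish.  At weight [1], the errors
    cancel by [sum_num_nonpos_eq1]. *)
Lemma num_cycle_order_add_nonpos (T : finType) (w : T -> int) (S : {set T}) :
  (forall x, w x <= 1)%R -> num_cycle_order w S + num_nonpos w S = #|S|`!.
Proof.
move=> w_le1; have [n] := ubnP #|S|; elim: n S => // n IHn S le_S.
have [->|S_neq0] := eqVneq S set0.
  rewrite cards0 num_cycle_order_rec !big_set0.
  by rewrite /num_nonpos enum_set0 (perm_big [:: [::]]) ?big_seq1.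
have S_gt0 : 0 < #|S| by rewrite card_gt0.
have IH x : x \in S ->
    num_cycle_order w (S :\ x) + num_nonpos w (S :\ x) = (#|S| - 1)`!.
  by move=> xS; move: le_S; rewrite (cardsD1 x) xS => /IHn->; rewrite addKn.
have sum_IH : \sum_(x in S) num_cycle_order w (S :\ x) +
    \sum_(x in S) num_nonpos w (S :\ x) = #|S|`!.
  rewrite -big_split /= (eq_bigr _ IH) sum_nat_const.
  by case: #|S| S_gt0 => // m _; rewrite subn1 factS.
rewrite num_cycle_order_rec; case: ifP => [/eqP sum_S|sum_S].
  rewrite num_nonpos0 ?sum_S // addn0 -(sum_num_nonpos_eq1 sum_S) addnC.
  exact: sum_IH.
rewrite add0n -sum_IH; congr (_ + _).
have [sum_le0|sum_gt0] := Order.TotalTheory.leP (\sum_(x in S) w x)%R 0%R.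
  exact: num_nonpos_rec.
rewrite num_nonpos0 // big1 // => x xS; apply: num_nonpos0.
have sum_x : (\sum_(y in S) w y = w x + \sum_(y in S :\ x) w y :> int)%R.
  exact: big_setD1.
by have := w_le1 x; lia.
Qed.

(** If [S] has positive weight, then so has every ordering of [S], as a suffix of
    itself: the correction term [num_nonpos w S] vanishes. *)
Lemma sum_unit_subset_fact (T : finType) (w : T -> int) (S : {set T}) :
  (forall x, w x <= 1)%R -> (0 < \sum_(x in S) w x)%R ->
  \sum_(A : {set T} | (A \subset S) && (\sum_(x in A) w x == 1)%R)
    (#|A| - 1)`! * #|S :\: A|`! = #|S|`!.
Proof.
move=> w_le1 sum_S.
by rewrite -(num_cycle_order_add_nonpos S w_le1) (num_nonpos0 sum_S) addn0.
Qed.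

(** * Colourings with classes of weight one *)

Lemma enum_option (T : finType) :
  enum {: option T} = None :: [seq Some x | x <- enum T].
Proof. by rewrite !enumT [in LHS]unlock. Qed.

Lemma big_option (R : Type) (idx : R) (op : Monoid.com_law idx) (T : finType)
    (F : option T -> R) :
  \big[op/idx]_x F x = op (F None) (\big[op/idx]_x F (Some x)).
Proof.
by rewrite -big_enum enum_option big_cons big_map big_enum.
Qed.

Definition color_class (T C : finType) (c : {ffun T -> C}) (j : C) : {set T} :=
  [set t | c t == j].

Lemma big_color_class (R : Type) (idx : R) (op : Monoid.com_law idx)
    (T C : finType) (c : {ffun T -> C}) (F : T -> R) :
  \big[op/idx]_t F t = \big[op/idx]_j \big[op/idx]_(t in color_class c j) F t.
Proof.
rewrite (partition_big c xpredT) //=; apply: eq_bigr => j _.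
by apply: eq_bigl => t; rewrite inE.
Qed.

(** The set [X] of colours in use varies during the induction, while the type
    of colours stays the same. *)
Definition unit_classes (T I : finType) (w : T -> int) (X : {set I})
    (c : {ffun T -> option I}) : bool :=
  [forall i, let A := color_class c (Some i) in
    if i \in X then (\sum_(t in A) w t == 1)%R else A == set0].

Definition recolor (T I : finType) (i : I)
    (cA : {ffun T -> option I} * {set T}) : {ffun T -> option I} :=
  [ffun t => if t \in cA.2 then Some i else cA.1 t].

Definition uncolor (T I : finType) (i : I) (c : {ffun T -> option I}) :
    {ffun T -> option I} * {set T} :=
  ([ffun t => if c t == Some i then None else c t], color_class c (Some i)).

Lemma uncolorK (T I : finType) (i : I) : cancel (@uncolor T I i) (recolor i).
Proof.
move=> c; apply/ffunP => t; rewrite ffunE inE /= ffunE.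
by case: eqP => [->|].
Qed.

(** Take a colour [i0] out of [X] and recolour its class [A] with [None].
    Conversely, [A] can be any subset of weight [1] of the new class [None].
    That class has positive weight, as the total weight is at least [#|X|] and
    only [#|X| - 1] of it lies in the other classes, so the sum over [A] is
    given by [sum_unit_subset_fact]. *)
Lemma unit_coloring_count (T I : finType) (w : T -> int) (X : {set I}) :
  (forall t, w t <= 1)%R -> (#|X|%:Z <= \sum_t w t)%R ->
  \sum_(c : {ffun T -> option I} | unit_classes w X c)
    #|color_class c None|`! * \prod_i (#|color_class c (Some i)| - 1)`!
  = #|T|`!.
Proof.
move=> w_le1; have [n] := ubnP #|X|; elim: n X => // n IHn X le_X sum_w.
have [->|[i0 Xi0]] := set_0Vmem X.
  rewrite (big_pred1 [ffun => None]) => [|c].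
    have class_None : color_class [ffun=> None : option I] None = [set: T].
      by apply/setP => t; rewrite !inE ffunE.
    rewrite class_None cardsT big1 ?muln1 // => i _.
    suff -> : color_class [ffun=> None : option I] (Some i) = set0 :> {set T}.
      by rewrite cards0.
    by apply/setP => t; rewrite !inE ffunE.
  apply/forallP/eqP => [class0|-> i].
    apply/ffunP => t; rewrite ffunE; case c_t: (c t) => [i|] //.
    by have := class0 i; rewrite inE => /eqP/setP/(_ t); rewrite !inE c_t eqxx.
  by rewrite inE; apply/eqP/setP => t; rewrite !inE ffunE.
set Y := X :\ i0.
have card_X : #|X| = #|Y|.+1 by rewrite (cardsD1 i0) Xi0.
rewrite -(IHn Y); try lia.
transitivity (\sum_(c : {ffun T -> option I} | unit_classes w Y c)
   \sum_(A : {set T} | (A \subset color_class c None)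
                       && (\sum_(t in A) w t == 1)%R)
   (#|A| - 1)`! * #|color_class c None :\: A|`!
     * \prod_i (#|color_class c (Some i)| - 1)`!); last first.
  apply: eq_bigr => c unit_c; rewrite -big_distrl sum_unit_subset_fact //=.
  have sum_c : (\sum_t w t = \sum_j \sum_(t in color_class c j) w t)%R.
    exact: big_color_class.
  have sum_Y : (\sum_(i : I) \sum_(t in color_class c (Some i)) w t
                = #|Y|%:Z)%R.
    rewrite (bigID (mem Y)) /= [X in (_ + X)%R]big1 ?GRing.addr0.
      rewrite (eq_bigr (fun=> 1%R)) => [|i Yi].
        by rewrite GRing.sumr_const natz.
      by have /forallP/(_ i) := unit_c; rewrite Yi => /eqP.
    move=> i /negPf nYi; have /forallP/(_ i) := unit_c; rewrite nYi => /eqP->.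
    by rewrite big_set0.
  have sum_None : (\sum_t w t =
      \sum_(t in color_class c None) w t + #|Y|%:Z :> int)%R.
    by rewrite sum_c big_option /= sum_Y.
  by move: sum_w; rewrite sum_None card_X; move: (\sum_(t in _) w t)%R; lia.
rewrite pair_big_dep /= (reindex_onto (recolor i0) (uncolor i0)) /=; last first.
  by move=> c _; rewrite uncolorK.
have classes c (A : {set T}) : A \subset color_class c None ->
   color_class c (Some i0) = set0 ->
   [/\ color_class (recolor i0 (c, A)) None = color_class c None :\: A,
       color_class (recolor i0 (c, A)) (Some i0) = A
     & forall i, i != i0 -> color_class (recolor i0 (c, A)) (Some i)
                            = color_class c (Some i)].
  move=> /subsetP sA c0; split => [||i ne_i]; apply/setP => t; rewrite !inE ffunE /=.
  - by case: ifP.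
  - by move/setP/(_ t): c0; rewrite !inE; case: (t \in A) => // _; rewrite eqxx.
  case: ifP => // /sA; rewrite inE => /eqP->.
  by rewrite eqE /= eq_sym (negPf ne_i).
have uncolorE c (A : {set T}) : (uncolor i0 (recolor i0 (c, A)) == (c, A)) =
   (A \subset color_class c None) && (color_class c (Some i0) == set0).
  apply/eqP/andP => [[eq_c eq_A]|[/subsetP sA /eqP/setP c0]].
    split; [apply/subsetP => t tA | apply/eqP/setP => t]; rewrite !inE -eq_c !ffunE /=.
      by rewrite tA eqxx.
    by case: ifP => // /negbTE.
  congr (_, _); [apply/ffunP => t | apply/setP => t]; have := c0 t;
    rewrite !inE !ffunE /=.
    by have [/sA|_ ->] := boolP (t \in A); rewrite // eqxx inE => /eqP->.
  by case: (t \in A) => [_|->]; rewrite ?eqxx.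
have Y_i0 : i0 \notin Y by rewrite setD11.
have YX i : i != i0 -> (i \in Y) = (i \in X) by move=> ne_i; rewrite !inE ne_i.
apply: eq_big => [[c A]|[c A]] /=; rewrite uncolorE.
  have [|] := boolP (A \subset _); rewrite ?andbF //= => sA.
  have [c0|c0] := eqVneq (color_class c (Some i0)) set0; last first.
    rewrite andbF; apply/esym/andP => -[/forallP/(_ i0)].
    by rewrite /= (negPf Y_i0) (negPf c0).
  have [_ class_i0 class_i] := classes c A sA c0.
  rewrite andbT; apply/forallP/andP => [unit_c|[/forallP unit_c wA] i].
    split; last by have := unit_c i0; rewrite Xi0 class_i0.
    apply/forallP => i; have [->|ne_i] := eqVneq i i0.
      by rewrite (negPf Y_i0) c0.
    by rewrite YX // -class_i // unit_c.
  have [->|ne_i] := eqVneq i i0; first by rewrite Xi0 class_i0.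
  by rewrite class_i // -YX // unit_c.
case/and3P => _ sA /eqP c0.
have [-> class_i0 class_i] := classes c A sA c0.
rewrite [RHS]mulnAC mulnC; congr (_ * _).
rewrite (bigD1 i0) //= [in RHS](bigD1 i0) //= class_i0 c0 cards0 mul1n.
by congr (_ * _); apply: eq_bigr => i /class_i ->.
Qed.

(** * Multinomial coefficients of partitions count colourings *)

(** The form free of division in which recursions are easily checked. *)
Lemma multinom_fact (C : finType) (h : nat) (g : C -> nat) :
  multinom h [seq g j | j <- enum C] * \prod_j (g j)`! =
  (h == \sum_j g j) * h`!.
Proof.
rewrite /multinom sumnE big_map big_enum big_map big_enum /=.
case: eqP => [->|_]; rewrite ?mul0n // mul1n divnK //.
have := dvdn_prod_fact [seq g j | j <- enum C].
by rewrite sumnE big_map big_enum big_map big_enum.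
Qed.

(** Among the ways to distribute [h.+1] objects over the colours, single out
    those that give the first object the colour [j]. *)
Lemma multinom_pascal (C : finType) (h : nat) (g : C -> nat) :
  multinom h.+1 [seq g j | j <- enum C] =
  \sum_j (0 < g j) * multinom h [seq g i - (j == i) | i <- enum C].
Proof.
have prod_gt0 : 0 < \prod_j (g j)`!.
  by apply: prodn_gt0 => j; apply: fact_gt0.
apply/eqP; rewrite -(eqn_pmul2r prod_gt0) multinom_fact big_distrl /=; apply/eqP.
have term j : (0 < g j) * multinom h [seq g i - (j == i) | i <- enum C]
    * \prod_i (g i)`! = g j * ((h.+1 == \sum_i g i) * h`!).
  case g_j: (g j) => [|m]; first by rewrite !mul0n.
  have -> : \prod_i (g i)`! = m.+1 * \prod_i (g i - (j == i))`!.
    rewrite (bigD1 j) //= [in RHS](bigD1 j) //= eqxx g_j subn1 factS mulnA.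
    by congr (_ * _); apply: eq_bigr => i ne_i; rewrite eq_sym (negPf ne_i) subn0.
  rewrite mul1n mulnCA multinom_fact; congr (_ * (_ * _)).
  rewrite (bigD1 j) //= [in RHS](bigD1 j) //= eqxx g_j subn1 addSn eqSS.
  congr (_ == (_ + _)).
  by apply: eq_bigr => i ne_i; rewrite eq_sym (negPf ne_i) subn0.
rewrite (eq_bigr _ (fun j _ => term j)) -big_distrl /=.
by case: eqP => [<-|_]; rewrite ?mul1n ?factS // !mul0n muln0.
Qed.

Definition cons_ffun (C : Type) (n : nat) (xc : C * {ffun 'I_n -> C}) :
    {ffun 'I_n.+1 -> C} :=
  [ffun t => oapp xc.2 xc.1 (unlift ord0 t)].

Lemma cons_ffun_bij (C : Type) (n : nat) : bijective (@cons_ffun C n).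
Proof.
exists (fun c : {ffun 'I_n.+1 -> C} => (c ord0, [ffun t => c (lift ord0 t)]))
  => [[x c]|c].
  congr (_, _); first by rewrite ffunE unlift_none.
  by apply/ffunP => t; rewrite !ffunE liftK.
apply/ffunP => t; rewrite ffunE.
by case: unliftP => [j ->|->] /=; rewrite ?ffunE.
Qed.

(** The number of colourings of [n] objects, where [t] has value [f t], such
    that [g v j] of the objects with value [v] receive the colour [j].  The
    colour of the first object affects only the factor of its value, where
    [multinom_pascal] applies. *)
Lemma count_colorings (V : eqType) (C : finType) (vs : seq V) (n : nat)
    (f : 'I_n -> V) (g : V -> C -> nat) :
  uniq vs -> (forall t, f t \in vs) ->
  \sum_(c : {ffun 'I_n -> C})
    all (fun v => [forall j, \sum_t ((f t == v) && (c t == j)) == g v j]) vs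
  = \prod_(v <- vs) multinom (\sum_t (f t == v)) [seq g v j | j <- enum C].
Proof.
move=> uniq_vs; elim: n f g => [|n IHn] f g f_vs.
  rewrite (eq_bigr (fun v => nat_of_bool [forall j, 0 == g v j])) => [|v _].
    rewrite (big_pred1 [ffun t : 'I_0 => match notF (ltn_ord t) with end]).
      elim: vs {uniq_vs f_vs} => [|v vs IHvs]; rewrite ?big_nil // big_cons -IHvs /=.
      rewrite mulnb; congr (nat_of_bool (_ && _)).
      by apply: eq_forallb => j; rewrite big_ord0.
    by move=> c; apply/esym/eqP/ffunP => -[].
  rewrite big_ord0 /multinom sumnE big_map big_enum eq_sym sum_nat_eq0 /=.
  rewrite (eq_forallb (fun j => eq_sym 0 (g v j))).
  case: ifP => // /forallP g0; rewrite big_map big_enum /= big1 ?divn1 // => j _.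
  by rewrite (eqP (g0 j)).
rewrite (reindex _ (onW_bij _ (@cons_ffun_bij C n))) -(pair_bigA _ (fun x c =>
  nat_of_bool (all (fun v => [forall j,
    \sum_t ((f t == v) && (cons_ffun (x, c) t == j)) == g v j]) vs))) /=.
pose v0 := f ord0; pose f' t := f (lift ord0 t).
pose g' x v j := g v j - ((v0 == v) && (x == j)).
transitivity (\sum_x (0 < g v0 x) * \prod_(v <- vs)
    multinom (\sum_t (f' t == v)) [seq g' x v j | j <- enum C]).
  apply: eq_bigr => x _; rewrite -IHn; last by move=> t; apply: f_vs.
  rewrite big_distrr /=; apply: eq_bigr => c _; rewrite mulnb; congr nat_of_bool.
  have sumE v j : \sum_t ((f t == v) && (cons_ffun (x, c) t == j)) =
      ((v0 == v) && (x == j)) + \sum_t ((f' t == v) && (c t == j)).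
    rewrite big_ord_recl ffunE unlift_none /=; congr (_ + _).
    by apply: eq_bigr => t _; rewrite ffunE liftK.
  apply/allP/andP => [eq_g|[g_gt0 /allP eq_g'] v v_vs].
    split.
      have /forallP/(_ x) := eq_g v0 (f_vs ord0).
      by rewrite sumE !eqxx => /eqP<-.
    apply/allP => v v_vs; apply/forallP => j.
    by have /forallP/(_ j) := eq_g v v_vs; rewrite sumE /g' => /eqP<-; rewrite addKn.
  apply/forallP => j; have /forallP/(_ j) /eqP := eq_g' v v_vs; rewrite sumE => ->.
  rewrite /g'; apply/eqP; case: eqP => [<-|_] /=; last by rewrite add0n subn0.
  by case: eqP => [<-|_] /=; rewrite ?subn0 // subnKC.
have v0_vs : v0 \in vs by apply: f_vs.
rewrite [RHS](bigD1_seq v0) //= big_ord_recl eqxx add1n multinom_pascal big_distrl.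
apply: eq_bigr => x _; rewrite (bigD1_seq v0) //= -mulnA; congr (_ * (_ * _)).
  by congr multinom; apply: eq_map => j; rewrite /g' eqxx.
apply: eq_bigr => v; rewrite eq_sym => /negPf ne_v.
rewrite big_ord_recl ne_v add0n; congr multinom.
by apply: eq_map => j; rewrite /g' ne_v subn0.
Qed.

Definition class_partition (n : nat) (C : finType) (f : 'I_n -> nat)
    (c : {ffun 'I_n -> C}) (j : C) : seq nat :=
  sort geq [seq f t | t <- enum (color_class c j)].

(** Weakly decreasing sequences are equal as soon as every value has the same
    multiplicity in both, so the colourings with classes [mus] are those of
    [count_colorings] for the multiplicities of the values in the [mus j]. *)
Lemma partmultinomE (n : nat) (C : finType) (f : 'I_n -> nat)
    (mus : C -> seq nat) :
  (forall t, 0 < f t) ->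
  (forall j, sorted geq (mus j)) -> (forall j, all (fun x => 0 < x) (mus j)) ->
  partmultinom [seq f t | t <- enum 'I_n] [seq mus j | j <- enum C] =
  \sum_(c : {ffun 'I_n -> C}) [forall j, mus j == class_partition f c j].
Proof.
move=> f_gt0 mus_sorted mus_gt0; rewrite /partmultinom.
set nu := [seq f t | t <- enum 'I_n]; set M := \max_(x <- _) x.
have le_M x : x \in nu ++ flatten [seq mus j | j <- enum C] -> x <= M.
  by move=> x_in; apply: (@leq_bigmax_seq _ _ xpredT id x).
have f_vs t : f t \in index_iota 1 M.+1.
  by rewrite mem_index_iota f_gt0 ltnS le_M // mem_cat map_f // mem_enum.
have mus_vs j x : x \in mus j -> x \in index_iota 1 M.+1.
  move=> x_j; rewrite mem_index_iota ltnS (allP (mus_gt0 j)) // le_M //.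
  rewrite mem_cat; apply/orP; right; apply/flattenP; exists (mus j) => //.
  by rewrite map_f // mem_enum.
have -> : \prod_(1 <= i < M.+1) multinom (count_mem i nu)
     [seq count_mem i mu | mu <- [seq mus j | j <- enum C]] =
   \prod_(1 <= i < M.+1) multinom (\sum_t (f t == i))
     [seq count_mem i (mus j) | j <- enum C].
  apply: eq_bigr => i _; rewrite -map_comp; congr multinom.
  rewrite count_map -sum1_count big_mkcond big_enum /=.
  by apply: eq_bigr => t _; case: eqP.
rewrite -(count_colorings _ (iota_uniq _ _) f_vs).
apply: eq_bigr => c _; congr nat_of_bool.
have countE v j : \sum_t ((f t == v) && (c t == j)) =
    count_mem v [seq f t | t <- enum (color_class c j)].
  rewrite count_map -sum1_count [RHS]big_mkcond big_enum /= [RHS]big_mkcond /=.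
  by apply: eq_bigr => t _; rewrite inE andbC; case: (c t == j) => //=; case: eqP.
have classE j : (mus j == class_partition f c j) =
    perm_eq (mus j) [seq f t | t <- enum (color_class c j)].
  have geq_trans : transitive geq by move=> y x z /= le_yx /leq_trans; apply.
  rewrite -[mus j in LHS](sorted_sort geq_trans) //.
  have geq_total : total geq by move=> x y; apply: leq_total.
  have geq_anti : antisymmetric geq.
    move=> x y /= le_xy.
    by apply: anti_leq; rewrite andbC.
  exact/eqP/(perm_sortP geq_total geq_trans geq_anti).
apply/allP/forallP => [eq_count j|eq_class v _].
  rewrite classE; apply/allP => v; rewrite mem_cat => v_in /=.
  rewrite -countE eq_sym; apply: (forallP (eq_count v _)).
  by case/orP: v_in => [/mus_vs|/mapP[t _ ->]].
apply/forallP => j; rewrite countE eq_sym.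
by have := eq_class j; rewrite classE => /permP->.
Qed.

Lemma class_partition_is_intpart (n : nat) (C : finType) (f : 'I_n -> nat)
    (c : {ffun 'I_n -> C}) (j : C) (k m : nat) :
  (forall t, 0 < f t) ->
  is_intpart k m (class_partition f c j) =
  (#|color_class c j| == k) && (\sum_(t in color_class c j) f t == m).
Proof.
move=> f_gt0; rewrite /is_intpart sort_sorted /=; last first.
  by move=> x y; apply: leq_total.
rewrite all_sort all_map (@eq_all _ _ predT) ?all_predT /=; last exact: f_gt0.
rewrite size_sort size_map -cardE; congr (_ && (_ == _)).
rewrite sumnE (perm_big _ (permEl (perm_sort geq _))) big_map.
by rewrite big_enum.
Qed.

(** * The theorem *)

(** A colouring determines the partitions of its classes: the sums over
    partitions on the right-hand side of the theorem have at most one nonzero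
    term. *)
Lemma sum_intpart_eq (k n : nat) (X : seq nat) :
  \sum_(mu : intpart k n) (parts mu == X) = is_intpart k n X.
Proof.
case: (boolP (is_intpart k n X)) => [X_part|X_npart].
  rewrite (bigD1 (IntPart X_part)) //= eqxx big1 // => mu ne_mu.
  by apply/eqP; rewrite eqb0; apply: contraNneq ne_mu => eq_mu; apply/eqP/val_inj.
rewrite big1 // => -[p p_part] _; apply/eqP; rewrite eqb0 /=.
by apply: contraNneq X_npart => <-.
Qed.

Lemma sum_dffun_intpart_eq (I : finType) (k n : I -> nat) (X : I -> seq nat) :
  \sum_(rho : {dffun forall i, intpart (k i) (n i)})
    [forall i, parts (rho i) == X i] =
  [forall i, is_intpart (k i) (n i) (X i)].
Proof.
case: (boolP [forall i, is_intpart _ _ _]) => [/forallP X_part|X_npart].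
  pose rho0 : {dffun forall i, intpart (k i) (n i)} :=
    [ffun i => IntPart (X_part i)].
  rewrite (bigD1 rho0) //= big1 ?addn0 => [|rho ne_rho].
    by rewrite (_ : [forall i, _]) //; apply/forallP => i; rewrite ffunE.
  apply/eqP; rewrite eqb0; apply: contraNN ne_rho => /forallP eq_rho.
  by apply/eqP/ffunP => i; apply/val_inj; rewrite ffunE; apply/eqP/eq_rho.
rewrite big1 // => rho _; apply/eqP; rewrite eqb0.
apply: contraNN X_npart => /forallP eq_rho; apply/forallP => i.
by rewrite -(eqP (eq_rho i)); case: (rho i).
Qed.

Lemma sum_weight (T : finType) (f : T -> nat) (A : {set T}) :
  (\sum_(t in A) (2 - (f t)%:Z) = 2 * #|A|%:Z - (\sum_(t in A) f t)%N%:Z)%R.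
Proof.
rewrite GRing.sumrB; congr (_ - _)%R.
  by rewrite GRing.sumr_const -[LHS]GRing.mulr_natr (natz #|A|).
by rewrite (big_morph Posz PoszD (erefl _)).
Qed.

Theorem theorem1 (k l s : nat) (hs : maxn (k + l) 1 <= s)
    (nu : intpart s (2 * s - k - l)) :
  s`! =
  \sum_(r < (s + l).+1)
    \sum_(p : {ffun 'I_l -> 'I_s.+1} |
            [&& l <= r, r - l + \sum_(i < l) p i == s, k <= r - l
              & [forall i, 1 <= p i]])
      \sum_(mu : intpart (r - l) (2 * r - k - 2 * l))
        \sum_(rho : {dffun forall i : 'I_l, intpart (p i) (2 * p i - 1)})
          partmultinom nu (parts mu :: [seq parts (rho i) | i <- enum 'I_l])
          * (r - l)`! * \prod_(i < l) (p i - 1)`!.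
Proof.
have [_ nu_gt0 /eqP size_nu /eqP sum_nu] := and4P (valP nu).
pose f (t : 'I_s) := nth 0 nu t; pose w (t : 'I_s) : int := (2 - (f t)%:Z)%R.
have f_gt0 t : 0 < f t by apply: (allP nu_gt0); rewrite mem_nth ?size_nu.
have nuE : parts nu = [seq f t | t <- enum 'I_s].
  by rewrite [RHS](map_comp (nth 0 nu) val) val_enum_ord -[in iota 0 s]size_nu
    -/(mkseq _ _) mkseq_nth.
have sum_f : \sum_t f t = 2 * s - k - l.
  by rewrite -sum_nu -[\val nu]/(parts nu) nuE sumnE big_map big_enum.
have w_le1 t : (w t <= 1)%R by have := f_gt0 t; rewrite /w; lia.
have sum_w : (#|[set: 'I_l]|%:Z <= \sum_t w t)%R.
  have := sum_weight f [set: 'I_s].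
  rewrite !(eq_bigl _ _ (in_setT (T := _))) sum_f !cardsT !card_ord => ->; lia.
rewrite -[in LHS](card_ord s) -(unit_coloring_count w_le1 sum_w).
(* Here [m] stands for [r - l]: the classes of [c] are partitions in the index
   sets of the sums over [mu] and [rho]. *)
pose matches (c : {ffun 'I_s -> option 'I_l}) (m : nat) (p : 'I_l -> nat) :=
  [&& #|color_class c None| == m,
      \sum_(t in color_class c None) f t == 2 * m - k
    & [forall i, (#|color_class c (Some i)| == p i) &&
                 (\sum_(t in color_class c (Some i)) f t == 2 * p i - 1)]].
transitivity (\sum_(r < (s + l).+1)
    \sum_(p : {ffun 'I_l -> 'I_s.+1} |
            [&& l <= r, r - l + \sum_(i < l) p i == s, k <= r - l
              & [forall i, 1 <= p i]])
      \sum_(c : {ffun 'I_s -> option 'I_l}) matches c (r - l) (fun i => p i)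
        * ((r - l)`! * \prod_(i < l) (p i - 1)`!)); last first.
  apply: eq_bigr => r _; apply: eq_bigr => p _.
  rewrite -big_distrl /=.
  under [RHS]eq_bigr => mu _ do rewrite -!big_distrl /=.
  rewrite -!big_distrl /= -mulnA /=; congr (_ * _).
  transitivity (\sum_(mu : intpart (r - l) (2 * r - k - 2 * l))
    \sum_(rho : {dffun forall i : 'I_l, intpart (p i) (2 * p i - 1)})
    \sum_(c : {ffun 'I_s -> option 'I_l})
      ((parts mu == class_partition f c None) *
      [forall i, parts (rho i) == class_partition f c (Some i)])); last first.
    apply: eq_bigr => mu _; apply: eq_bigr => rho _.
    pose mus j := if j is Some i then parts (rho i) else parts mu.
    have -> : parts mu :: [seq parts (rho i) | i <- enum 'I_l] =
        [seq mus j | j <- enum {: option 'I_l}].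
      by rewrite enum_option /= -map_comp.
    have mus_part j : sorted geq (mus j) /\ all (fun x => 0 < x) (mus j).
      by case: j => [i|]; [have /and4P[] := valP (rho i) | have /and4P[] := valP mu].
    rewrite nuE partmultinomE => //; try by move=> j; have [] := mus_part j.
    apply: eq_bigr => c _; rewrite mulnb; congr nat_of_bool.
    apply/andP/forallP => [[eq_mu /forallP eq_rho] [i|]|eq_mus] //=.
    by split; [apply: (eq_mus None) | apply/forallP => i; apply: (eq_mus (Some i))].
  under [RHS]eq_bigr => mu _ do rewrite exchange_big /=.
  rewrite [RHS]exchange_big /=; apply: eq_bigr => c _.
  under [RHS]eq_bigr => mu _ do rewrite -big_distrr /=.
  rewrite -big_distrl /= sum_intpart_eq (sum_dffun_intpart_eq _ _
    (fun i => class_partition f c (Some i))) mulnb class_partition_is_intpart //.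
  rewrite -andbA /matches; congr (nat_of_bool [&& _, _ == _ & _]); first lia.
  by apply: eq_forallb => i; rewrite class_partition_is_intpart.
under [RHS]eq_bigr => r _ do rewrite exchange_big /=.
rewrite [RHS]exchange_big /= big_mkcond /=; apply: eq_bigr => c _.
rewrite pair_big_dep /=.
(* Only the pair [(r0, p0)] of class sizes can match [c]; it does so and meets
   the summation conditions if and only if the classes [Some i] of [c] have
   weight one. *)
have class_le j : #|color_class c j| <= s.
  by rewrite -[X in _ <= X]card_ord max_card.
have wE j : (\sum_(t in color_class c j) w t =
  2 * #|color_class c j|%:Z - (\sum_(t in color_class c j) f t)%N%:Z :> int)%R.
  exact: sum_weight.
case: ifP => unit_c; last first.
  rewrite big1 // => -[r p] /=; case/and4P=> _ _ _ /forallP p_gt0.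
  case: (boolP (matches _ _ _)); rewrite ?mul0n // => /and3P[_ _ /forallP match_p].
  case/negP: unit_c; apply/forallP => i; rewrite inE /= wE; apply/eqP.
  by have /andP[/eqP-> /eqP->] := match_p i; have := p_gt0 i; lia.
have class_i i : 0 < #|color_class c (Some i)| /\
    \sum_(t in color_class c (Some i)) f t = 2 * #|color_class c (Some i)| - 1.
  have /forallP/(_ i) := unit_c; rewrite inE /= wE => /eqP.
  by move: #|_| (\sum_(t in _) f t) => a b; lia.
have sum_card : #|color_class c None| + \sum_i #|color_class c (Some i)| = s.
  have : \sum_(t < s) 1 = \sum_j \sum_(t in color_class c j) 1.
    exact: big_color_class.
  rewrite sum1_card card_ord big_option sum1_card /=.
  move=> sum_s; rewrite [RHS]sum_s; congr (_ + _).
  by apply: eq_bigr => i _; rewrite sum1_card.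
have [sum_None le_k] : \sum_(t in color_class c None) f t =
    2 * #|color_class c None| - k /\ k <= #|color_class c None|.
  have sum_unit : \sum_i \sum_(t in color_class c (Some i)) f t + l =
      2 * \sum_i #|color_class c (Some i)|.
    rewrite -[X in _ + X]card_ord -sum1_card -big_split big_distrr /=.
    apply: eq_bigr => i _; have [c_gt0 ->] := class_i i.
    by rewrite subnK // muln_gt0.
  have le_None : #|color_class c None| <= \sum_(t in color_class c None) f t.
    by rewrite -sum1_card leq_sum.
  have : \sum_t f t = \sum_j \sum_(t in color_class c j) f t.
    exact: big_color_class.
  rewrite sum_f big_option /=.
  have arith (f0 f1 n0 n1 : nat) : n0 + n1 = s -> f1 + l = 2 * n1 -> n0 <= f0 ->
    2 * s - k - l = f0 + f1 -> f0 = 2 * n0 - k /\ k <= n0 by lia.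
  exact: arith sum_card sum_unit le_None.
have r0_lt : #|color_class c None| + l < (s + l).+1 by rewrite ltnS leq_add2r.
pose r0 : 'I_(s + l).+1 := Ordinal r0_lt.
pose p0 : {ffun 'I_l -> 'I_s.+1} :=
  [ffun i => inord #|color_class c (Some i)|].
have p0E i : p0 i = #|color_class c (Some i)| :> nat.
  by rewrite ffunE inordK // ltnS.
rewrite (bigD1 (r0, p0)) /=; last first.
  rewrite leq_addl addnK (eq_bigr _ (fun i _ => p0E i)) sum_card eqxx /=.
  apply/andP; split=> //.
  by apply/forallP => i; rewrite p0E; have [] := class_i i.
rewrite [X in _ + X]big1 ?addn0 => [|[r p] /=].
  have -> : matches c (#|color_class c None| + l - l) (fun i => p0 i).
    rewrite /matches addnK sum_None !eqxx /=.
    by apply/forallP => i; rewrite p0E; have [_ ->] := class_i i; rewrite !eqxx.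
  rewrite mul1n addnK; congr (_ * _).
  by apply: eq_bigr => i _; rewrite p0E.
case/andP=> /and4P[le_lr _ _ _] ne_rp; apply/eqP.
rewrite muln_eq0 eqb0; apply/orP; left; apply: contraNN ne_rp.
case/and3P => /eqP eq_r _ /forallP eq_p; apply/eqP; congr (_, _).
  by apply/val_inj; rewrite /= eq_r subnK.
apply/ffunP => i; apply/val_inj => /=; rewrite p0E.
by have /andP[/eqP-> _] := eq_p i.
Qed.
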